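(* With probability at least $1-\delta$, the algorithm Multi-Round $\varepsilon$-Arm (described in the context), run by $k$ players with input $(\varepsilon,\delta)$, (1) identifies an $\varepsilon$-optimal arm (the optimal arm when $\varepsilon=0$) using $$O\left(\frac1k\cdot\sum_{i=2}^n\frac1{(\Delta_i^\varepsilon)^2}\log\Big(\frac n\delta\log\frac1{\Delta_i^\varepsilon}\Big)\right)$$ arm pulls per player; (2) terminates after no more than $1+\lceil\log_2(1/\varepsilon)\rceil$ rounds of communication (or after $1+\lceil\log_2(1/\Delta_\star)\rceil$ rounds for $\varepsilon=0$).
   Context: There are $k\ge1$ players and $n$ arms. Each pull of arm $i$ by a player yields an independent sample of a $[0,1]$-valued reward with unknown expectation $p_i$. For convenience of notation, arms are ordered so that $p_1\ge p_2\ge\dots\ge p_n$ (the players do not know this order). $\Delta_i:=p_1-p_i$, $\Delta_i^\varepsilon:=\max\{\Delta_i,\varepsilon\}$ and $\Delta_\star:=\Delta_2$ is the minimal gap. An arm $i$ is $\varepsilon$-optimal if $p_i\ge p_1-\varepsilon$. When $\varepsilon=0$ the best (optimal) arm is assumed unique. In a communication round each player broadcasts a message to all other players. Algorithm Multi-Round $\varepsilon$-Arm with input $(\varepsilon,\delta)$: initialize $S_0=[n]$, $r=0$, $t_0=0$. Repeat: set $r\leftarrow r+1$; let $\varepsilon_r=2^{-r}$ and $t_r=\frac{2}{k\varepsilon_r^2}\ln\frac{4nr^2}{\delta}$. Each player $j=1,\dots,k$ samples each arm $i\in S_{r-1}$ for $t_r-t_{r-1}$ times, lets $\hat p^{\,r}_{j,i}$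 be the average reward of arm $i$ in all rounds so far of player $j$, and communicates the numbers $\hat p^{\,r}_{j,1},\dots,\hat p^{\,r}_{j,n}$ (one communication round). Let $\hat p_i^{\,r}=\frac1k\sum_{j=1}^k\hat p^{\,r}_{j,i}$ for $i\in S_{r-1}$ and $\hat p_\star^{\,r}=\max_{i\in S_{r-1}}\hat p_i^{\,r}$; set $S_r=S_{r-1}\setminus\{i\in S_{r-1}:\hat p_i^{\,r}<\hat p_\star^{\,r}-\varepsilon_r\}$. Stop when $\varepsilon_r\le\varepsilon/2$ or $|S_r|=1$, and return an arm from $S_r$.
   Formalization: The real t_r is rounded up to whole pulls, so the pull bound gains an extra +n unless t_1 ≥ 1 (the literal bound fails for large k); the inner log(1/Δ_i^ε) is read as max(1, ln(1/Δ_i^ε)); n ≥ 2 and ε ≤ 1 are assumed, as the bounds fail or are undefined otherwise. *)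

(* Defs.v *)
From HB Require Import structures.
From mathcomp Require Export all_boot all_order all_algebra.
From mathcomp Require Export all_classical all_reals all_analysis.

Set Implicit Arguments.
Unset Strict Implicit.
Unset Printing Implicit Defensive.

Import Order.TTheory GRing.Theory Num.Theory.
Import numFieldNormedType.Exports.

Local Open Scope ring_scope.

(* Mutual independence of a family of random variables: the product rule over
   every finite subfamily. *)
Definition mutually_independent (R : realType) (d : measure_display)
    (Omega : measurableType d) (P : probability Omega R) (I : choiceType)
    (Y : I -> {RV P >-> R}) : Prop :=
  forall (s : seq I) (B : I -> set R), uniq s ->
    (forall i, measurable (B i)) ->
    (P (\bigcap_(i in [set` s]) (Y i @^-1` B i))%classic =
     \prod_(i <- s) P (Y i @^-1` B i)%classic)%E.

(* [X j i s] is the reward of the [s]-th pull (counted from 0) of arm [i] by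
   player [j].  Since all pulls are independent, running an adaptive strategy
   amounts to reading the rewards off this table in order. *)
Record bandit_rewards (R : realType) (d : measure_display)
    (Omega : measurableType d) (P : probability Omega R) (k n : nat)
    (p : 'I_n -> R) (X : 'I_k -> 'I_n -> nat -> {RV P >-> R}) : Prop :=
  BanditRewards {
    reward_in01 : forall j i s w, 0 <= X j i s w <= 1;
    reward_mean : forall j i s, ('E_P[X j i s] = (p i)%:E)%E;
    reward_same_law : forall i j j' s s' (B : set R), measurable B ->
      distribution P (X j i s) B = distribution P (X j' i s') B;
    reward_independent :
      mutually_independent (fun a : 'I_k * 'I_n * nat => X a.1.1 a.1.2 a.2)
  }.

Section Gaps.
Context {R : realType} {n : nat}.

(* The arms p_1 and p_2 of the informal numbering from 1. *)
Definition arm1 (hn : (1 < n)%N) : 'I_n := Ordinal (ltnW hn).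
Definition arm2 (hn : (1 < n)%N) : 'I_n := Ordinal hn.

Definition gap (hn : (1 < n)%N) (p : 'I_n -> R) (i : 'I_n) : R :=
  p (arm1 hn) - p i.

Definition gap_eps (hn : (1 < n)%N) (p : 'I_n -> R) (eps : R) (i : 'I_n) : R :=
  Num.max (gap hn p i) eps.

Definition min_gap (hn : (1 < n)%N) (p : 'I_n -> R) : R := gap hn p (arm2 hn).

Definition eps_optimal (hn : (1 < n)%N) (p : 'I_n -> R) (eps : R)
    (i : 'I_n) : Prop :=
  p (arm1 hn) - eps <= p i.

End Gaps.

Section Algorithm.
Context {R : realType} {k n : nat}.

Definition eps_ (r : nat) : R := 2 ^- r.

Definition t_ (delta : R) (r : nat) : R :=
  if r is 0%N then 0
  else 2 / (k%:R * eps_ r ^+ 2) * ln (4 * n%:R * r%:R ^+ 2 / delta).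

(* The real number [t_ r] is rounded up: after round [r] each player has made
   [pulls_upto r] pulls of every arm which is sampled in round [r]. *)
Definition pulls_upto (delta : R) (r : nat) : nat :=
  `|Num.ceil (t_ delta r)|%N.

Definition player_mean (delta : R) (x : 'I_k -> 'I_n -> nat -> R) (r : nat)
    (j : 'I_k) (i : 'I_n) : R :=
  (\sum_(s < pulls_upto delta r) x j i s) / (pulls_upto delta r)%:R.

Definition joint_mean (delta : R) (x : 'I_k -> 'I_n -> nat -> R) (r : nat)
    (i : 'I_n) : R :=
  k%:R^-1 * \sum_(j < k) player_mean delta x r j i.

(* The set S_r.  The default value 0 of the maximum is harmless as the rewards
   are nonnegative.  The sets are also defined after the algorithm has stopped;
   see [stops_at]. *)
Fixpoint survivors (delta : R) (x : 'I_k -> 'I_n -> nat -> R) (r : nat)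
    : {set 'I_n} :=
  if r is r'.+1 then
    let S := survivors delta x r' in
    let best := \big[Num.max/0]_(i in S) joint_mean delta x r i in
    S :\: finset (fun i => (i \in S) && (joint_mean delta x r i < best - eps_ r))
  else [set: 'I_n]%SET.

Definition stop_test (eps delta : R) (x : 'I_k -> 'I_n -> nat -> R) (r : nat)
    : bool :=
  (eps_ r <= eps / 2) || (#|survivors delta x r| == 1%N).

(* The algorithm stops after exactly [T] rounds. *)
Definition stops_at (eps delta : R) (x : 'I_k -> 'I_n -> nat -> R) (T : nat)
    : Prop :=
  [/\ (0 < T)%N, stop_test eps delta x T
    & forall r, (0 < r < T)%N -> ~~ stop_test eps delta x r].

(* The number of pulls by each single player in rounds 1, ..., T; all players
   make the same pulls. *)
Definition pulls_per_player (delta : R) (x : 'I_k -> 'I_n -> nat -> R)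
    (T : nat) : nat :=
  \sum_(1 <= r < T.+1) \sum_(i in survivors delta x r.-1)
     (pulls_upto delta r - pulls_upto delta r.-1).

End Algorithm.
Arguments t_ {R} k n delta r.

(* The expression inside the O.  As log(1/Delta) vanishes for Delta = 1, the
   inner logarithm is read as max(1, log(1/Delta)), which is log(1/Delta)
   itself as soon as Delta <= 1/e. *)
Definition pull_bound (R : realType) (k n : nat) (hn : (1 < n)%N)
    (p : 'I_n -> R) (eps delta : R) : R :=
  k%:R^-1 * \sum_(i < n | i != arm1 hn)
    (1 / gap_eps hn p eps i ^+ 2 *
     ln (n%:R / delta * Num.max 1 (ln (1 / gap_eps hn p eps i)))).

Definition log2 (R : realType) (x : R) : R := ln x / ln 2.

Definition round_bound (R : realType) (n : nat) (hn : (1 < n)%N)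
    (p : 'I_n -> R) (eps : R) : int :=
  1 + Num.ceil (log2 (1 / (if eps == 0 then min_gap hn p else eps))).

(* Main.v *)
(** On the event that, after each of the finitely many possible rounds, the joint
mean of every arm is within [eps_ r / 2] of its expectation, the optimal arm
always survives and an arm surviving round [r] has gap below [2 * eps_ r]; the
correctness and the bound on the number of rounds follow.  A suboptimal arm is
then pulled only in rounds [r] with [2 ^ r <= 4 / gap_eps], so it is pulled at most
[t_ r] times (rounded up) for the last such [r]; the pulls of the optimal arm are
charged to a suboptimal arm that survives as long.  By Hoeffding's inequality,
arm [i] deviates in round [r] with probability at most [delta / (2 n r ^ 2)], and
these probabilities sum to at most [delta]. *)

Require Import Defs.
From mathcomp Require Import measurable_realfun ring lra.

Import Order.TTheory GRing.Theory Num.Theory.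
Import numFieldNormedType.Exports.

Set Implicit Arguments.
Unset Strict Implicit.
Unset Printing Implicit Defensive.

Local Open Scope ring_scope.

(** * Independence *)

Section Weight.
Import HBNNSimple.
Local Open Scope classical_set_scope.
Local Open Scope ereal_scope.
Context d d' (T : measurableType d) (T' : measurableType d') (R : realType).
Variables (mu : {measure set T -> \bar R}) (Y : {mfun T >-> T'}).

(** The densities [h] and [c] give the same measure to every event of [Y]. The equality extends to
    simple functions of [Y] by linearity and then to [g] by monotone convergence. *)
Lemma ge0_integral_comp_weight (h : T -> R) (c : R) (g : T' -> R) :
  measurable_fun [set: T] h -> (forall w, (0 <= h w)%R) -> (0 <= c)%R ->
  (forall B, measurable B ->
    \int[mu]_(w in Y @^-1` B) (h w)%:E = c%:E * mu (Y @^-1` B)) ->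
  measurable_fun [set: T'] g -> (forall y, (0 <= g y)%R) ->
  \int[mu]_w ((g (Y w))%:E * (h w)%:E) = c%:E * \int[mu]_w (g (Y w))%:E.
Proof.
move=> mh h0 c0 hB mg g0.
pose f := EFin \o g.
have mf : measurable_fun [set: T'] f by exact/measurable_EFinP.
have f0 y : 0 <= f y by rewrite lee_fin.
pose s := nnsfun_approx measurableT mf.
have s0 n y : (0 <= s n y)%R by [].
have ms n : measurable_fun [set: T] (EFin \o s n \o Y).
  by apply: measurableT_comp => //; apply/measurable_EFinP.
have nds y m n : (m <= n)%N -> (s m y <= s n y)%R.
  by move=> mn; exact/lefP/nd_nnsfun_approx.
have mh' : measurable_fun [set: T] (EFin \o h) by exact/measurable_EFinP.
have mYB (B : set T') : measurable B -> measurable (Y @^-1` B).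
  by move=> mB; exact: measurable_funPTI.
have step n : \int[mu]_w ((s n (Y w))%:E * (h w)%:E) =
    c%:E * \int[mu]_w (s n (Y w))%:E.
  pose B r := Y @^-1` (s n @^-1` [set r]).
  have mB r : measurable (B r) by apply: mYB; exact: measurable_funPTI.
  (* For negative [r] the fibre [B r] is empty, so the sign holds for every [r]. *)
  have B0 r w : 0 <= (r * \1_(B r) w)%:E := nnfun_muleindic_ge0 (s n) r (Y w).
  have sE w : (s n (Y w))%:E = \sum_(r \in range (s n)) (r * \1_(B r) w)%:E.
    by rewrite fsumEFin// {1}fimfunE.
  have mrB r : measurable_fun [set: T] (fun w => (r * \1_(B r) w)%:E).
    by apply/measurable_EFinP; apply: measurable_funM.
  under eq_integral.
    move=> w _; rewrite sE ge0_mule_fsuml//.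
    over.
  under [in RHS]eq_integral do rewrite sE.
  rewrite !ge0_integral_fsum//; last 2 first.
    by move=> r; apply: emeasurable_funM => //; exact: mrB.
    by move=> r w _; apply: mule_ge0 => //; rewrite ?B0 ?lee_fin.
  rewrite ge0_mule_fsumr//; last first.
    by move=> r; apply: integral_ge0.
  apply: eq_fsbigr => r; rewrite inE => -[y _ /= yr].
  have r0 : (0 <= r)%R by rewrite -yr.
  under eq_integral do rewrite EFinM -muleA.
  under [in RHS]eq_integral do rewrite EFinM.
  have mi : measurable_fun [set: T] (fun w => (\1_(B r) w : R)%:E).
    exact/measurable_EFinP.
  rewrite !ge0_integralZl//; last 2 first.
  - exact: emeasurable_funM.
  - by move=> w _; rewrite mule_ge0// lee_fin.
  rewrite integral_indic// setIT muleCA; congr (_ * _).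
  rewrite /B -hB//.
  rewrite [RHS]integral_mkcond; apply: eq_integral => w _.
  rewrite patchE indicE; case: ifP => _; by rewrite ?mul1e ?mul0e.
have sY w : EFin \o (fun n => s n (Y w)) @ \oo --> f (Y w).
  by apply: cvg_nnsfun_approx.
have L1 : (fun n => \int[mu]_w ((s n (Y w))%:E * (h w)%:E)) @ \oo -->
    \int[mu]_w ((g (Y w))%:E * (h w)%:E).
  have -> : \int[mu]_w ((g (Y w))%:E * (h w)%:E) =
     \int[mu]_w (limn (fun n => (s n (Y w))%:E * (h w)%:E)).
    apply: eq_integral => w _; apply/esym/cvg_lim => //.
    by apply: cvgeZr => //; exact: sY.
  apply: cvg_monotone_convergence => //.
  - by move=> n; apply: emeasurable_funM => //; exact: ms.
  - by move=> n w _; rewrite mule_ge0// lee_fin.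
  - by move=> w _ m n mn; rewrite lee_wpmul2r ?lee_fin ?nds.
have L2 : (fun n => c%:E * \int[mu]_w (s n (Y w))%:E) @ \oo -->
    c%:E * \int[mu]_w (g (Y w))%:E.
  apply: cvgeZl => //.
  have -> : \int[mu]_w ((g (Y w))%:E) = \int[mu]_w (limn (fun n => (s n (Y w))%:E)).
    by apply: eq_integral => w _; apply/esym/cvg_lim => //; exact: sY.
  apply: cvg_monotone_convergence => //.
  - by move=> n w _; rewrite lee_fin.
  - by move=> w _ m n mn; rewrite lee_fin; exact: nds.
by apply: (cvg_unique _ L1); rewrite ?(funext step)//; exact: L2.
Qed.
End Weight.

(** * Expectation of a product of independent factors *)

Section ProductExpectation.
Local Open Scope classical_set_scope.
Local Open Scope ereal_scope.
Context (R : realType) d (T : measurableType d) (P : probability T R).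
Context (I : choiceType) (Y : I -> {RV P >-> R}).
Hypothesis indY : mutually_independent Y.
Variables (g : I -> R -> R) (e : I -> R).
Hypothesis mg : forall i, measurable_fun [set: R] (g i).
Hypothesis g0 : forall i y, (0 <= g i y)%R.
Hypothesis eE : forall i, \int[P]_w (g i (Y i w))%:E = (e i)%:E.

Let mprod (s : seq I) :
  measurable_fun [set: T] (fun w => \prod_(i <- s) g i (Y i w))%R.
Proof. by apply: measurable_prod => i _; exact: measurableT_comp. Qed.

Let mcap (s : seq I) (B : I -> set R) : (forall i, measurable (B i)) ->
  measurable (\bigcap_(i in [set` s]) (Y i @^-1` B i)).
Proof.
move=> mB; apply: fin_bigcap_measurable; first exact: finite_seq.
by move=> i _; exact: measurable_funPTI.
Qed.

(* Induction on [s1] trades an event for a nonnegative function, one variable at a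
   time. *)
Lemma independent_integral_prod_setI (s1 s2 : seq I) (B : I -> set R) :
  uniq (s1 ++ s2) -> (forall i, measurable (B i)) ->
  \int[P]_(w in \bigcap_(i in [set` s2]) (Y i @^-1` B i))
      (\prod_(i <- s1) g i (Y i w))%:E =
  (\prod_(i <- s1) e i)%:E * \prod_(i <- s2) P (Y i @^-1` B i).
Proof.
elim: s1 s2 B => [|i s1 IH] s2 B us mB.
  under eq_integral do rewrite big_nil.
  rewrite big_nil mul1e integral_cst ?mul1e; last exact: mcap.
  by apply: indY.
(* The factor of [i] is split off; the remaining factors, restricted to [D], form the weight [h]. *)
pose D := \bigcap_(i in [set` s2]) (Y i @^-1` B i).
have mD : measurable D by exact: mcap.
pose h w := ((\prod_(i <- s1) g i (Y i w)) * \1_D w)%R.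
have e0 j : (0 <= e j)%R.
  by rewrite -lee_fin -eE; apply: integral_ge0 => w _; rewrite lee_fin.
have pf : \prod_(i <- s2) P (Y i @^-1` B i) =
    (\prod_(i <- s2) fine (P (Y i @^-1` B i)))%:E.
  rewrite -prodEFin; apply: eq_bigr => j _; rewrite fineK//.
  by apply: fin_num_measure; exact: measurable_funPTI.
have hE C : measurable C -> \int[P]_(w in Y i @^-1` C) (h w)%:E =
    (\prod_(i <- s1) e i * \prod_(i <- s2) fine (P (Y i @^-1` B i)))%:E
    * P (Y i @^-1` C).
  move=> mC.
  pose B' j := if j == i then C else B j.
  have is2 : i \notin s2.
    by move: us; rewrite /= mem_cat negb_or => /andP[/andP[]].
  have PE : \prod_(j <- i :: s2) P (Y j @^-1` B' j) =
      P (Y i @^-1` C) * \prod_(j <- s2) P (Y j @^-1` B j).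
    rewrite big_cons; congr (_ * _); first by rewrite /B' eqxx.
    apply: eq_big_seq => j js2; rewrite /B' ifF//.
    by apply: contraNF is2 => /eqP <-.
  have uis2 : uniq (s1 ++ i :: s2).
    by rewrite -(perm_uniq (s1 := i :: s1 ++ s2))// perm_sym -cat1s perm_catCA.
  have mB' j : measurable (B' j) by rewrite /B'; case: ifP.
  rewrite EFinM -pf -muleA [_ * P _]muleC -PE -(IH _ _ uis2 mB').
  have -> : \bigcap_(j in [set` i :: s2]) (Y j @^-1` B' j) = (Y i @^-1` C) `&` D.
    apply/seteqP; split=> w /=.
      move=> H; split; first by have := H i; rewrite /= mem_head /B' eqxx; apply.
      move=> j /= js; have := H j; rewrite /= inE js orbT /B' ifF; first exact.
      by apply: contraNF is2 => /eqP <-.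
    move=> [H1 H2] j /=; rewrite inE /B'; case: eqP => [->//|_ /= js].
    exact: H2.
  rewrite integral_mkcondr; apply: eq_integral => w _.
  by rewrite /h patchE indicE; case: ifP => _; rewrite ?mulr1 ?mulr0.
have := @ge0_integral_comp_weight _ _ _ _ _ P (Y i) h _ (g i) _ _ _ hE (mg i) (g0 i).
rewrite eE => H.
transitivity (\int[P]_w ((g i (Y i w))%:E * (h w)%:E)).
  rewrite integral_mkcond; apply: eq_integral => w _.
  rewrite patchE big_cons /h indicE -EFinM.
  by case: ifP => _; rewrite ?mulr1 ?mulr0.
rewrite H.
- by rewrite pf big_cons -!EFinM; congr EFin; ring.
- by apply: measurable_funM => //; exact: measurable_indic.
- move=> w; apply: mulr_ge0; first by apply: prodr_ge0 => j _; exact: g0.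
  by rewrite indicE.
- by apply: mulr_ge0; apply: prodr_ge0 => j _ //; rewrite fine_ge0.
Qed.

Lemma independent_integral_prod (s : seq I) : uniq s ->
  \int[P]_w (\prod_(i <- s) g i (Y i w))%:E = (\prod_(i <- s) e i)%:E.
Proof.
move=> us; have := @independent_integral_prod_setI s [::] (fun=> setT).
rewrite cats0 big_nil mule1 => <-//; congr integral.
by apply/seteqP; split.
Qed.

End ProductExpectation.

(** * Hoeffding's inequality *)

Section MomentBound.
Context {R : realType}.
Implicit Types p x l : R.

(** The derivative rules produce scalings; as products they are accessible to [ring] and [field]. *)
Lemma regular_scaleE (a b : R) : a *: (b : R^o) = a * b.
Proof. by []. Qed.

Lemma is_derive_ge0_le (f df : R -> R) (a b : R) :
  (forall x, is_derive x 1 f (df x)) -> (forall x, a <= x -> 0 <= df x) ->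
  a <= b -> f a <= f b.
Proof.
move=> fdf df0 ab.
have cf : {within `[a, b], continuous f}%classic.
  by apply: derivable_within_continuous => x _; exact: ex_derive.
have [c] := MVT_segment ab (fun x _ => fdf x) cf.
rewrite in_itv /= => /andP[ac _] fE.
by rewrite -subr_ge0 fE mulr_ge0 ?subr_ge0 ?df0.
Qed.

(** This is Hoeffding's lemma for a Bernoulli variable of mean [p]. The difference of the logarithms
    vanishes at 0 together with its derivative, and its second derivative is nonnegative. *)
Lemma expR_bernoulli_le_ge0 p l : 0 <= p <= 1 -> 0 <= l ->
  1 - p + p * expR l <= expR (l * p + l ^+ 2 / 8).
Proof.
move=> /andP[p0 p1] l0.
pose D x := 1 - p + p * expR x.
have D0 x : 0 < D x.
  have := expR_gt0 x; rewrite /D; have [->|pn0] := eqVneq p 0; first by lra.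
  move=> ex; have : 0 < p * expR x by rewrite mulr_gt0// lt_neqAle eq_sym pn0.
  lra.
have dD x : is_derive x 1 D (p * expR x).
  have -> : D = cst (1 - p) + p \*: expR by [].
  by apply: is_derive_eq; rewrite add0r.
(* [G] is the derivative of the difference [F] of the logarithms of both sides, and
   [G' >= 0] by AM-GM. *)
pose G x := x / 4 + p - 1 + (1 - p) * (D x)^-1.
have dG x : is_derive x 1 G (4^-1 - (1 - p) * (p * expR x) / D x ^+ 2).
  have dV : is_derive x 1 (fun y => (D y)^-1) (- (D x) ^- 2 *: (p * expR x)).
    by apply: is_deriveV; rewrite gt_eqF.
  have -> : G = 4^-1 \*: id + cst (p - 1) + (1 - p) \*: (fun y => (D y)^-1).
    apply/funext => y; rewrite /G.
    by rewrite -[RHS]/(4^-1 * y + (p - 1) + (1 - p) * (D y)^-1); ring.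
  apply: is_derive_eq.
  rewrite !regular_scaleE. ring.
have G00 : G 0 = 0 by rewrite /G /D expR0 mulr1 subrK invr1; ring.
have G0 x : 0 <= x -> 0 <= G x.
  move=> x0; rewrite -G00; apply: (is_derive_ge0_le dG _ x0) => y _.
  rewrite subr_ge0 ler_pdivrMr ?exprn_gt0// /D.
  have := sqr_ge0 (1 - p - p * expR y); nra.
pose F x := x * p + x ^+ 2 / 8 - ln (D x).
have dF x : is_derive x 1 F (G x).
  have dL : is_derive x 1 (@ln R \o D) ((D x)^-1 * (p * expR x)).
    by apply: is_derive1_comp; exact: is_derive1_ln.
  have -> : F = p \*: id + 8^-1 \*: (id ^+ 2) - (@ln R \o D).
    apply/funext => y; rewrite /F.
    rewrite -[RHS]/(p * y + 8^-1 * (id ^+ 2 : R -> R) y - ln (D y)) exprfctE; ring.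
  apply: is_derive_eq; rewrite /G !regular_scaleE.
  have := D0 x; rewrite /D => H; field; lra.
have F00 : F 0 = 0 by rewrite /F /D expR0 mulr1 subrK ln1; ring.
have F0 : 0 <= F l by rewrite -F00; exact: (is_derive_ge0_le dF).
rewrite -/(D l) -[D l]lnK ?posrE// ler_expR -subr_ge0; exact: F0.
Qed.

(* The case [l < 0] follows by exchanging the two outcomes. *)
Lemma expR_bernoulli_le p l : 0 <= p <= 1 ->
  1 - p + p * expR l <= expR (l * p + l ^+ 2 / 8).
Proof.
move=> p01; have [|l0] := leP 0 l; first exact: expR_bernoulli_le_ge0.
have H : _ <= _ := @expR_bernoulli_le_ge0 (1 - p) (- l) ltac:(lra) ltac:(lra).
have -> : 1 - p + p * expR l = expR l * (1 - (1 - p) + (1 - p) * expR (- l)).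
  have := expRxMexpNx_1 l; nra.
have -> : l * p + l ^+ 2 / 8 = l + (- l * (1 - p) + (- l) ^+ 2 / 8) by field.
by rewrite [leRHS]expRD ler_pM2l ?expR_gt0.
Qed.

(** By convexity of [expR] on the segment from 0 to [l]. This compares a variable in [0,1] with the
    Bernoulli variable of the same mean. *)
Lemma expR_chord_le l x : 0 <= x <= 1 -> expR (l * x) <= 1 - x + x * expR l.
Proof.
move=> /andP[x0 x1].
have := convex_expR (Itv01 x0 x1) l 0.
rewrite !convRE /=.
rewrite expR0 mulr0 addr0 mulr1 /unstable.onem [x * l]mulrC; lra.
Qed.
End MomentBound.

(** * Exponential moments and tails of sums *)

Section Hoeffding.
Local Open Scope classical_set_scope.
Local Open Scope ereal_scope.
Context (R : realType) d (T : measurableType d) (P : probability T R).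

(** The chord is affine in [X], so its integral depends on the mean only. *)
Lemma integral_chord (X : {RV P >-> R}) (p c : R) :
  (forall w, (0 <= X w <= 1)%R) -> 'E_P[X] = p%:E -> (0 <= c)%R ->
  \int[P]_w ((1 - X w) + X w * c)%:E = ((1 - p) + p * c)%:E.
Proof.
move=> X01 EX c0.
have intX : P.-integrable [set: T] (fun w => (X w)%:E).
  apply: (@le_integrable _ _ _ P _ measurableT _ (cst 1)) => //.
  - exact/measurable_EFinP.
  - by move=> w _ /=; rewrite lee_fin normr1 ger0_norm; case/andP: (X01 w).
  - exact: finite_measure_integrable_cst.
have int1 : P.-integrable [set: T] (fun=> 1%:E : \bar R).
  exact: finite_measure_integrable_cst.
have -> : (fun w => ((1 - X w) + X w * c)%:E) =
    (fun w => 1%:E + (c - 1)%:E * (X w)%:E).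
  by apply/funext => w; rewrite -EFinM -EFinD; congr EFin; ring.
rewrite integralD//; last exact: integrableZl.
rewrite integralZl// -[X in _ * X]expectation_def EX.
rewrite integral_cst//= probability_setT mule1 -EFinM -EFinD; congr EFin; ring.
Qed.

Lemma mean_in01 (X : {RV P >-> R}) (p : R) :
  (forall w, (0 <= X w <= 1)%R) -> 'E_P[X] = p%:E -> (0 <= p <= 1)%R.
Proof.
move=> X01 EX; apply/andP; split.
  by rewrite -lee_fin -EX; apply: expectation_ge0 => w; case/andP: (X01 w).
rewrite -lee_fin -EX -(expectation_cst P 1).
apply: expectation_le => //; last by apply/aeW => w; case/andP: (X01 w).
by move=> w; case/andP: (X01 w).
Qed.

Lemma hoeffding_mgf (X : {RV P >-> R}) (p l : R) :
  (forall w, (0 <= X w <= 1)%R) -> 'E_P[X] = p%:E ->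
  \int[P]_w (expR (l * (X w - p)))%:E <= (expR (l ^+ 2 / 8))%:E.
Proof.
move=> X01 EX.
have mX : measurable_fun [set: T] X by [].
have m1 : measurable_fun [set: T] (fun w => expR (l * (X w - p))).
  apply: measurableT_comp => //; apply: measurable_funM => //.
  exact: measurable_funB.
have m2 : measurable_fun [set: T] (fun w => (1 - X w) + X w * expR l)%R.
  by apply: measurable_funD; [exact: measurable_funB|exact: measurable_funM].
have m2_ge0 w : (0 <= (1 - X w) + X w * expR l)%R.
  have /andP[X0 X1] := X01 w.
  by rewrite addr_ge0 ?subr_ge0// mulr_ge0// expR_ge0.
apply: (@le_trans _ _
    (\int[P]_w (((1 - X w) + X w * expR l) * expR (- (l * p)))%:E)).
  apply: ge0_le_integral => //.
  - exact/measurable_EFinP.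
  - by apply/measurable_EFinP; exact: measurable_funM.
  - move=> w _; rewrite lee_fin mulrBr expRD ler_pM2r ?expR_gt0//.
    exact: expR_chord_le.
under eq_integral do rewrite mulrC EFinM.
rewrite ge0_integralZl//; first last.
- by move=> w _; rewrite lee_fin.
- exact/measurable_EFinP.
rewrite (integral_chord X01 EX) ?expR_ge0//.
rewrite -EFinM lee_fin expRN mulrC ler_pdivrMr ?expR_gt0// -expRD.
have := expR_bernoulli_le l (mean_in01 X01 EX).
by rewrite [(l ^+ 2 / 8 + _)%R]addrC.
Qed.

Context (I : choiceType) (Y : I -> {RV P >-> R}) (p : R).
Hypothesis indY : mutually_independent Y.
Hypothesis Y01 : forall i w, (0 <= Y i w <= 1)%R.
Hypothesis EY : forall i, 'E_P[Y i] = p%:E.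

Lemma measurable_centered_sum (s : seq I) :
  measurable_fun [set: T] (fun w => \sum_(i <- s) (Y i w - p))%R.
Proof. by apply: measurable_sum => i; exact: measurable_funB. Qed.

(** The sign [c] treats both tails at once. Chernoff's bound is applied at [4 * a], the minimiser of
    [l ^+ 2 / 8 - l * a], whose minimum is [- 2 * a ^+ 2]. *)
Let hoeffding_signed (c : R) (s : seq I) (a : R) : (c ^+ 2 = 1)%R -> uniq s ->
  (0 < a)%R ->
  P [set w | (size s)%:R * a <= c * \sum_(i <- s) (Y i w - p)]%R <=
  (expR (- (2 * (size s)%:R * a ^+ 2)))%:E.
Proof.
move=> c1 us a0.
have mS : measurable_fun [set: T] (fun w => c * \sum_(i <- s) (Y i w - p))%R.
  by apply: measurable_funM => //; exact: measurable_centered_sum.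
pose S : {RV P >-> R} := mfun_Sub (mem_set mS).
have a40 : (0 < 4 * a)%R by rewrite mulr_gt0.
apply: (le_trans (chernoff S _ a40)).
pose g (i : I) (y : R) := expR (4 * a * c * (y - p)).
pose e i := fine (\int[P]_w (g i (Y i w))%:E).
have mg i : measurable_fun [set: R] (g i).
  apply: measurableT_comp => //; apply: measurable_funM => //.
  exact: measurable_funB.
have g_ge0 i y : (0 <= g i y)%R by exact: expR_ge0.
have ge_le i : \int[P]_w (g i (Y i w))%:E <= (expR (2 * a ^+ 2))%:E.
  apply: (le_trans (hoeffding_mgf (4 * a * c) (Y01 i) (EY i))).
  by rewrite !exprMn c1 lee_fin ler_expR; lra.
have ge_ge i : 0 <= \int[P]_w (g i (Y i w))%:E.
  by apply: integral_ge0 => w _; rewrite lee_fin.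
have eE i : \int[P]_w (g i (Y i w))%:E = (e i)%:E.
  rewrite fineK// ge0_fin_numE//; apply: le_lt_trans (ge_le i) _; exact: ltry.
(* By independence the moment generating function of the sum factors. *)
have -> : 'M_P S (4 * a)%R = (\prod_(i <- s) e i)%:E.
  rewrite -(independent_integral_prod indY mg g_ge0 eE us).
  rewrite /mmt_gen_fun unlock; apply: eq_integral => w _ /=.
  rewrite /g -expR_sum -mulr_sumr; congr (expR _)%:E; ring.
have ele : (\prod_(i <- s) e i <= expR ((size s)%:R * (2 * a ^+ 2)))%R.
  apply: (@le_trans _ _ (\prod_(i <- s) expR (2 * a ^+ 2))%R).
    apply: ler_prod => i _; rewrite -!lee_fin -eE ge_ge/=.
    exact: ge_le.
  by rewrite -expR_sum big_const_seq count_predT iter_addr_0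
    [leRHS](congr1 expR (mulr_natl _ _)).
rewrite -EFinM lee_fin; apply: (le_trans (ler_wpM2r (expR_ge0 _) ele)).
rewrite -expRD ler_expR; lra.
Qed.

Lemma hoeffding (s : seq I) (a : R) : uniq s -> (0 < a)%R ->
  P [set w | (size s)%:R * a <= `|\sum_(i <- s) (Y i w - p)|]%R <=
  (2 * expR (- (2 * (size s)%:R * a ^+ 2)))%:E.
Proof.
move=> us a0.
pose A c := [set w | (size s)%:R * a <= c * \sum_(i <- s) (Y i w - p)]%R.
have mA c : measurable (A c).
  have := @measurable_fun_le _ T R setT (cst ((size s)%:R * a)%R)
    (fun w => c * \sum_(i <- s) (Y i w - p))%R measurableT.
  rewrite setTI; apply => //.
  by apply: measurable_funM => //; exact: measurable_centered_sum.
have AU : [set w | (size s)%:R * a <= `|\sum_(i <- s) (Y i w - p)|]%R =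
    A 1%R `|` A (-1)%R.
  by apply/seteqP; split=> w; rewrite /A /= ler_normr mul1r mulN1r => /orP.
rewrite AU; apply: (@le_trans _ _ (P (A 1%R) + P (A (-1)%R))).
  exact: measureU2.
rewrite mulr_natl mulr2n EFinD.
by apply: leeD; apply: hoeffding_signed; rewrite ?sqrrN ?expr1n.
Qed.
End Hoeffding.

(** * Concentration of the joint means *)

Section Schedule.
Context {R : realType} (k n : nat) (delta : R).
Hypotheses (k0 : (0 < k)%N) (n1 : (1 < n)%N) (d01 : 0 < delta < 1).

Lemma eps_gt0 r : 0 < eps_ r :> R.
Proof. by rewrite /eps_ invr_gt0 exprn_gt0. Qed.

Lemma ln_arg_gt1 r : (0 < r)%N -> 1 < 4 * n%:R * r%:R ^+ 2 / delta.
Proof.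
move=> r0; have /andP[d0 d1] := d01.
rewrite ltr_pdivlMr// mul1r.
have r1 : 1 <= r%:R ^+ 2 :> R by rewrite exprn_ege1// ler1n.
have nn : 1 <= n%:R :> R by rewrite ler1n ltnW.
nra.
Qed.

Lemma t_gt0 r : (0 < r)%N -> 0 < t_ k n delta r.
Proof.
case: r => // r _; rewrite /t_; apply: mulr_gt0.
  by rewrite divr_gt0// mulr_gt0 ?exprn_gt0 ?eps_gt0 ?ltr0n.
by rewrite ln_gt0// ln_arg_gt1.
Qed.

Lemma t_ge0 r : 0 <= t_ k n delta r.
Proof. by case: r => // r; rewrite ltW// t_gt0. Qed.

Lemma t_homo r r' : (r <= r')%N -> t_ k n delta r <= t_ k n delta r'.
Proof.
case: r => [|r]; first by move=> _; exact: t_ge0.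
case: r' => // r' rr'; rewrite /t_.
have /andP[d0 d1] := d01.
have h (a : R) : 2 / (k%:R * a ^+ 2) = 2 / k%:R * a ^- 2.
  by rewrite invfM mulrA.
rewrite !h; apply: ler_pM.
- by rewrite mulr_ge0 ?divr_ge0 ?invr_ge0 ?sqr_ge0.
- by rewrite ltW// ln_gt0// ln_arg_gt1.
- apply: ler_wpM2l; first by rewrite divr_ge0.
  rewrite /eps_ !exprVn !invrK ler_sqr ?nnegrE ?exprn_ge0//.
  by apply: ler_weXn2l => //; rewrite ler1n.
rewrite ler_ln ?posrE ?(lt_trans _ (ln_arg_gt1 _))//.
rewrite ler_pM2r ?invr_gt0//; apply: ler_wpM2l; first by rewrite mulr_ge0.
by rewrite ler_sqr ?nnegrE// ler_nat.
Qed.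

Local Notation pulls := (@pulls_upto R k n delta).

(** As [t_] is nonnegative, the absolute value in [pulls_upto] changes nothing. *)
Lemma pullsE r : (pulls r)%:R = (Num.ceil (t_ k n delta r))%:~R :> R.
Proof.
rewrite /pulls_upto natr_absz ger0_norm// ceil_ge0.
by apply: lt_le_trans (t_ge0 _); rewrite ltrN10.
Qed.

Lemma pulls_ge r : t_ k n delta r <= (pulls r)%:R.
Proof. by rewrite pullsE; exact: ceil_ge. Qed.

(** Rounding up costs at most one pull per arm; summed over the arms this becomes the additive
    [n%:R] of the theorem. *)
Lemma pulls_le r : (pulls r)%:R <= t_ k n delta r + 1.
Proof. by rewrite pullsE -lerBlDr -[1]/(1%:~R) -intrB ltW// ceilB1_lt. Qed.

Lemma pulls_homo r r' : (r <= r')%N -> (pulls r <= pulls r')%N.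
Proof.
by move=> rr'; rewrite -(ler_nat R) !pullsE ler_int le_ceil// t_homo.
Qed.

Lemma pulls_gt0 r : (0 < r)%N -> (0 < pulls r)%N.
Proof.
by move=> r0; rewrite -(ltr0n R); exact: lt_le_trans (t_gt0 r0) (pulls_ge _).
Qed.

End Schedule.

(** An injective reindexing keeps indices distinct, and the left inverse [g] carries the sets [B]
    over to the new indices. *)
Lemma mutually_independent_comp (R : realType) d (T : measurableType d)
    (P : probability T R) (I J : choiceType) (Y : J -> {RV P >-> R})
    (f : I -> J) (g : J -> I) :
  cancel f g -> mutually_independent Y -> mutually_independent (Y \o f).
Proof.
move=> fK indY s B us mB.
have := indY (map f s) (B \o g) _ (fun j => mB (g j)).
rewrite (map_inj_uniq (can_inj fK)) => /(_ us).
rewrite big_map; under eq_bigr do rewrite /= fK.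
move=> <-; congr (P _); apply/seteqP; split=> w /= H.
  by move=> j /= /mapP[i si ->]; rewrite /= fK; exact: H.
by move=> i si; have /= := H (f i); rewrite fK; apply; exact: map_f.
Qed.

(** * Hoeffding's inequality for the pooled rewards *)

Section Concentration.
Context (R : realType) (k n : nat) (delta : R).
Hypotheses (k0 : (0 < k)%N) (n1 : (1 < n)%N) (d01 : 0 < delta < 1).
Context d (T : measurableType d) (P : probability T R).
Context (p : 'I_n -> R) (X : 'I_k -> 'I_n -> nat -> {RV P >-> R}).
Hypothesis BX : bandit_rewards p X.
Local Notation jmean w := (joint_mean delta (fun j i s => X j i s w)).

(** All players have equally many samples of arm [i], so the average of their averages is the
    average of the pooled sample [s]. *)
Lemma joint_mean_dev r i w : (0 < r)%N ->
  let s := [seq (j, u) | j <- enum 'I_k, u <- iota 0 (@pulls_upto R k n delta r)] in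
  (size s)%:R * (jmean w r i - p i) = \sum_(a <- s) (X a.1 i a.2 w - p i).
Proof.
move=> r0 /=; set m := pulls_upto _ _.
have m0 : m%:R != 0 :> R by rewrite pnatr_eq0 -lt0n pulls_gt0.
have kn0 : k%:R != 0 :> R by rewrite pnatr_eq0 -lt0n.
rewrite size_allpairs size_iota size_enum_ord big_allpairs /=.
rewrite big_enum /= natrM.
have -> : \sum_(j < k) \sum_(u <- iota 0 m) (X j i u w - p i) =
    \sum_(j < k) \sum_(u < m) X j i u w - k%:R * m%:R * p i.
  rewrite -mulrA !mulr_natl -[X in _ *+ X]card_ord -sumr_const -sumrB.
  apply: eq_bigr => j _.
  rewrite -[X in iota 0 X]subn0 -/(index_iota 0 m) big_mkord sumrB.
  by rewrite sumr_const card_ord.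
rewrite /joint_mean /player_mean -/m -mulr_suml mulrBr; congr (_ - _).
by rewrite mulrACA mulfV// mul1r mulrCA mulfV// mulr1.
Qed.

Lemma joint_mean_concentration r i : (0 < r)%N ->
  (P [set w | eps_ r / 2 <= `|jmean w r i - p i|]%R%classic
   <= (delta / (2 * n%:R * r%:R ^+ 2))%:E)%E.
Proof.
move=> r0; have /andP[d0 d1] := d01.
have tE : t_ k n delta r =
    2 / (k%:R * eps_ r ^+ 2) * ln (4 * n%:R * r%:R ^+ 2 / delta) by case: r r0.
set m := @pulls_upto R k n delta r.
have m0 : 0 < m%:R :> R by rewrite ltr0n pulls_gt0.
have kn0 : 0 < k%:R :> R by rewrite ltr0n.
pose s := [seq (j, u) | j <- enum 'I_k, u <- iota 0 m].
have us : uniq s.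
  by apply: allpairs_uniq; rewrite ?enum_uniq ?iota_uniq// => -[? ?] [? ?] /=.
have ss : (size s)%:R = k%:R * m%:R :> R.
  by rewrite size_allpairs size_iota size_enum_ord natrM.
pose Y (a : 'I_k * nat) := X a.1 i a.2.
have indY : mutually_independent Y.
  have := @mutually_independent_comp R _ T P _ _ _
    (fun a : 'I_k * nat => (a.1, i, a.2)) (fun b => (b.1.1, b.2)) _
    (reward_independent BX).
  by apply => -[].
have a0 : 0 < eps_ r / 2 :> R by rewrite divr_gt0// eps_gt0.
have := hoeffding indY (fun a w => reward_in01 BX a.1 i a.2 w)
  (fun a => reward_mean BX a.1 i a.2) us a0.
have -> : [set w | (size s)%:R * (eps_ r / 2) <=
      `|\sum_(a <- s) (Y a w - p i)|]%classic
   = [set w | eps_ r / 2 <= `|jmean w r i - p i|]%classic.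
  apply/seteqP; split=> w /=; rewrite -joint_mean_dev// -/m -/s normrM;
  by rewrite ger0_norm ?ler0n// ler_pM2l// ss mulr_gt0.
move=> /le_trans; apply; rewrite lee_fin.
have L0 : 0 < 4 * n%:R * r%:R ^+ 2 / delta :> R.
  by apply: lt_trans (ln_arg_gt1 n1 d01 r0).
apply: (@le_trans _ _ (2 * expR (- ln (4 * n%:R * r%:R ^+ 2 / delta)))).
  (* With [k * m] samples and deviation [eps_ r / 2], Hoeffding's exponent is
     [k * m * eps_ r ^+ 2 / 2]; [t_] is the value of [m] for which it equals the logarithm. *)
  apply: ler_wpM2l => //; rewrite ler_expR lerN2 ss.
  have := pulls_ge k0 n1 d01 r; rewrite -/m.
  rewrite tE mulrAC ler_pdivrMr; last by rewrite mulr_gt0 ?exprn_gt0 ?eps_gt0.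
  nra.
rewrite expRN lnK ?posrE// le_eqVlt; apply/orP; left; apply/eqP.
field; rewrite ?gt_eqF ?ltr0n//= ltnW//.
Qed.
End Concentration.

(** * A run in which all joint means are close *)

Section RoundLogarithm.
Context {R : realType}.

(** Equivalent to [expR (- 2^-1) >= 2^-1], which follows from the tangent of [expR] at 0. *)
Lemma ln2_ge_half : 2^-1 <= ln 2 :> R.
Proof.
rewrite -ler_expR lnK ?posrE// -[2^-1]opprK expRN -[leRHS]invrK.
rewrite lef_pV2 ?posrE ?expR_gt0 ?invr_gt0//.
have := @expR_ge1Dx R (- 2^-1); lra.
Qed.

(* With [L] the maximum and [q = n / delta >= 2], the hypothesis on [r] yields
   [4 * r ^ 2 <= 64 * L ^ 2 <= q ^ 6 * L ^ 2]. *)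
Lemma ln_round_le (n r : nat) (delta D : R) :
  (1 < n)%N -> (0 < r)%N -> 0 < delta < 1 -> 0 < D <= 1 -> 2 ^+ r <= 4 / D ->
  ln (4 * n%:R * r%:R ^+ 2 / delta) <=
  7 * ln (n%:R / delta * Num.max 1 (ln (1 / D))).
Proof.
move=> n1 r0 /andP[d0 d1] /andP[D0 D1] rD.
set L := Num.max 1 _; set q := n%:R / delta.
have L1 : 1 <= L by rewrite /L le_max lexx.
have LD : ln (1 / D) <= L by rewrite /L le_max lexx orbT.
have n2 : 2 <= n%:R :> R by rewrite ler_nat.
have q2 : 2 <= q by rewrite /q ler_pdivlMr//; nra.
have r1 : 1 <= r%:R :> R by rewrite ler1n.
(* Taking logarithms, [r * ln 2 <= 2 * ln 2 + L], hence [r <= 2 + 2 * L], and [1 <= L]. *)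
have rL : r%:R <= 4 * L.
  have h2 := ln2_ge_half.
  have : ln (2 ^+ r) <= ln (4 / D).
    by rewrite ler_ln ?posrE ?exprn_gt0 ?divr_gt0.
  have lnX m : ln (2 ^+ m) = m%:R * ln 2 :> R by rewrite lnXn// mulr_natl.
  rewrite lnX lnM ?posrE ?invr_gt0//.
  have -> : 4 = 2 ^+ 2 :> R by rewrite -natrX.
  rewrite lnX => H.
  move: LD; rewrite div1r => LD; nra.
rewrite [leRHS]mulr_natl -lnXn; last first.
  by rewrite mulr_gt0 ?(lt_le_trans _ q2)// (lt_le_trans _ L1).
have -> : 4 * n%:R * r%:R ^+ 2 / delta = q * (4 * r%:R ^+ 2) by rewrite /q; ring.
have r2 : 4 * r%:R ^+ 2 <= 64 * L ^+ 2 by nra.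
have q64 : 64 <= q ^+ 6.
  by have -> : 64 = 2 ^+ 6 :> R; [rewrite -natrX|rewrite lerXn2r// nnegrE; lra].
have L7 : L ^+ 2 <= L ^+ 7 by exact: ler_weXn2l.
have L20 : 0 <= L ^+ 2 by exact: sqr_ge0.
have le1 : 64 * L ^+ 2 <= q ^+ 6 * L ^+ 7.
  by apply: ler_pM.
have q0 : 0 < q by lra.
rewrite ler_ln ?posrE.
- have -> : (q * L) ^+ 7 = q * (q ^+ 6 * L ^+ 7) by ring.
  by rewrite ler_pM2l// (le_trans r2).
- by rewrite mulr_gt0// mulr_gt0// exprn_gt0//; lra.
- by rewrite exprn_gt0// mulr_gt0//; lra.
Qed.

End RoundLogarithm.

(** * Survival, elimination and the number of rounds *)

Section Run.
Context {R : realType} (k n : nat) (hn : (1 < n)%N).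
Context (p : 'I_n -> R) (eps delta : R) (x : 'I_k -> 'I_n -> nat -> R).
Hypotheses (k0 : (0 < k)%N) (d01 : 0 < delta < 1).
Hypothesis p_sorted : forall i j : 'I_n, (i <= j)%N -> p j <= p i.
Hypothesis p01 : forall i, 0 <= p i <= 1.
Hypothesis x_ge0 : forall j i s, 0 <= x j i s.
Hypothesis eps01 : 0 <= eps <= 1.
Hypothesis min_gap_gt0 : eps = 0 -> 0 < min_gap hn p.

Local Notation S := (survivors delta x).
Local Notation jm := (joint_mean delta x).
Local Notation a1 := (arm1 hn).

(** This is the scale inside [round_bound]: the run ends at the latest once [eps_ r] is at most half
    of it. *)
Let target : R := if eps == 0 then min_gap hn p else eps.
Definition last_round : nat := `|round_bound hn p eps|%N.
Local Notation N := last_round.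

Lemma gap_ge0 i : 0 <= gap hn p i.
Proof. by rewrite subr_ge0 p_sorted. Qed.

Lemma gap_le1 i : gap hn p i <= 1.
Proof. have := p01 a1; have := p01 i; rewrite /gap; lra. Qed.

Lemma min_gap_le i : i != a1 -> min_gap hn p <= gap hn p i.
Proof.
move=> ia; rewrite lerD2l lerN2; apply: p_sorted.
by rewrite lt0n; apply: contraNneq ia => i0; apply/eqP/val_inj.
Qed.

Lemma target01 : 0 < target <= 1.
Proof.
rewrite /target; case: eqVneq => [e0|e0].
  by rewrite min_gap_gt0//= gap_le1.
by move/andP: eps01 => [h ->]; rewrite lt_neqAle eq_sym e0 h.
Qed.

Lemma gap_eps01 i : i != a1 -> 0 < gap_eps hn p eps i <= 1.
Proof.
move=> ia; rewrite /gap_eps lt_max ge_max gap_le1.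
have /andP[h0 ->] := eps01; rewrite !andbT.
have [e0|e0] := eqVneq eps 0; last by rewrite orbC lt_neqAle eq_sym e0 h0.
by rewrite (lt_le_trans (min_gap_gt0 e0)) ?min_gap_le.
Qed.

Lemma round_boundE : N%:Z = round_bound hn p eps.
Proof.
rewrite /last_round gez0_abs// /round_bound -/target.
rewrite addr_ge0// ceil_ge0 (lt_le_trans (ltrN10 _))// /log2.
have /andP[t0 t1] := target01.
by rewrite divr_ge0 ?ln_ge0 ?ler1n// ler_pdivlMr ?mul1r.
Qed.

Lemma last_round_gt0 : (0 < N)%N.
Proof.
rewrite -ltz_nat round_boundE /round_bound -/target.
rewrite ltr_pwDl// ceil_ge0 (lt_le_trans (ltrN10 _))// /log2.
have /andP[t0 t1] := target01.
by rewrite divr_ge0 ?ln_ge0 ?ler1n// ler_pdivlMr ?mul1r.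
Qed.

(** The summand 1 in [round_bound] supplies the factor 2 in [2 ^+ N >= 2 / target]. *)
Lemma eps_last_round : eps_ N <= target / 2.
Proof.
have /andP[t0 t1] := target01.
have : log2 (1 / target) <= (N%:R - 1 : R).
  have := ceil_ge (log2 (1 / target)).
  have -> : Num.ceil (log2 (1 / target)) = N%:Z - 1.
    by rewrite round_boundE /round_bound -/target addrC addKr.
  by rewrite intrB.
rewrite /log2 ler_pdivrMr ?ln_gt0 ?ltr1n// => h.
have -> : target / 2 = (2 / target)^-1 by rewrite invfM invrK mulrC.
rewrite /eps_ lef_pV2 ?posrE ?exprn_gt0 ?divr_gt0//.
rewrite -ler_ln ?posrE ?exprn_gt0 ?divr_gt0// lnXn// lnM ?posrE ?invr_gt0//.
by move: h; rewrite div1r -(mulr_natl (ln 2)); lra.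
Qed.

(** Eliminated arms are included: [joint_mean] reads the full reward table, so the event does not
    refer to the choices of the algorithm. *)
Hypothesis good : forall r i, (0 < r <= N)%N -> `|jm r i - p i| < eps_ r / 2.

Lemma joint_mean_ge0 r i : 0 <= jm r i.
Proof.
rewrite mulr_ge0 ?invr_ge0//; apply: sumr_ge0 => j _.
by rewrite /player_mean divr_ge0//; apply: sumr_ge0.
Qed.

(** Any arm and the optimal arm each deviate by less than [eps_ r / 2], so the optimal arm trails
    the leader by at most [eps_ r]. *)
Lemma best_arm_survives r : (r <= N)%N -> a1 \in S r.
Proof.
elim: r => [|r IH] rN; first by rewrite inE.
have Sr := IH (ltnW rN).
rewrite /= !inE Sr /= andbT -leNgt lerBlDr.
have e0 := @eps_gt0 R r.+1.
(* The default value 0 of the maximum has to obey the bound too. *)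
apply: bigmax_le; first by rewrite addr_ge0 ?joint_mean_ge0// ltW.
move=> i _.
have /ltr_normlP[_ h1] := good i (rN : (0 < r.+1 <= N)%N).
have /ltr_normlP[h2 _] := good a1 (rN : (0 < r.+1 <= N)%N).
have := gap_ge0 i; rewrite /gap; lra.
Qed.

(* The inequality is strict, so that a gap which is a power of 2 does not cost an
   additional round. *)
Lemma survivor_gap r i : (0 < r <= N)%N -> i \in S r -> gap hn p i < 2 * eps_ r.
Proof.
case: r => // r rN; rewrite /= !inE => /andP[+ iS].
rewrite iS /= -leNgt => h.
(* The optimal arm competes for the maximum, so [i] trails it by at most [eps_] in joint mean; the
   two deviations add less than another [eps_]. *)
have h1 : jm r.+1 a1 <= \big[Num.max/0]_(i in S r) jm r.+1 i.
  by apply: le_bigmax_cond; exact: best_arm_survives (ltnW rN).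
have /ltr_normlP[_ h2] := good i rN.
have /ltr_normlP[h3 _] := good a1 rN.
rewrite /gap; lra.
Qed.

Lemma survivors1 r i : (r <= N)%N -> #|S r| == 1%N -> i \in S r -> i = a1.
Proof.
move=> rN /cards1P[j Sj]; have := best_arm_survives rN.
by rewrite Sj !inE => /eqP -> /eqP.
Qed.

(** For positive [eps] the accuracy test holds. For [eps = 0] a suboptimal survivor would have a gap
    below [2 * eps_ N <= min_gap], so only the optimal arm is left. *)
Lemma stop_last_round : stop_test eps delta x N.
Proof.
apply/orP; have := eps_last_round; rewrite /target.
case: eqVneq => [e0 h|_]; [right|by left].
apply/cards1P; exists a1; apply/setP => i; rewrite inE.
apply/idP/eqP => [iS|->]; last exact: best_arm_survives.
apply/eqP; apply: contraT => /min_gap_le.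
have := survivor_gap (introT andP (conj last_round_gt0 (leqnn _))) iS; lra.
Qed.

Lemma stops_by_last_round : exists2 T, stops_at eps delta x T & (T <= N)%N.
Proof.
have ex : exists T, (0 < T)%N && stop_test eps delta x T.
  by exists N; rewrite last_round_gt0 stop_last_round.
case: (ex_minnP ex) => T /andP[T0 sT] Tmin; exists T; last first.
  by apply: Tmin; rewrite last_round_gt0 stop_last_round.
split=> // r /andP[r0 rT]; apply: contraL rT => sr.
by rewrite -leqNgt; apply: Tmin; rewrite r0.
Qed.

(** * Correctness and pulls up to the stopping round *)

Section Stopped.
Variable T : nat.
Hypothesis stopT : stops_at eps delta x T.
Hypothesis TN : (T <= N)%N.

(** Either [2 * eps_ T <= eps] bounds the gap, which is impossible for [eps = 0], or the only
    survivor is the optimal arm. *)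
Lemma survivors_optimal i : i \in S T ->
  eps_optimal hn p eps i /\ (eps = 0 -> i = a1).
Proof.
move=> iS; have [T0 /orP[he|c1] _] := stopT.
  split; last by move=> e0; exfalso; move: he (@eps_gt0 R T); rewrite e0; lra.
  have := survivor_gap (introT andP (conj T0 TN)) iS.
  rewrite /gap /eps_optimal; lra.
rewrite (survivors1 TN c1 iS); split=> //.
by rewrite /eps_optimal; case/andP: eps01; lra.
Qed.

(** Round [r.-1], if there was one, neither eliminated [i] nor met the stopping test, so the gap and
    [eps] are both below [2 * eps_ r.-1]. For [r = 1] the bound [gap_eps <= 1] suffices. *)
Lemma survivor_round i r : i != a1 -> (0 < r <= T)%N -> i \in S r.-1 ->
  2 ^+ r <= 4 / gap_eps hn p eps i.
Proof.
move=> ia /andP[r0 rT] iS.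
have /andP[D0 D1] := gap_eps01 ia.
rewrite ler_pdivlMr//; case: r r0 rT iS => // -[_ _ _|r _ rT iS].
  by rewrite expr1; lra.
have [_ _ /(_ r.+1 rT)] := stopT; rewrite negb_or -ltNge => /andP[he _].
have hg := survivor_gap (leq_trans (ltnW rT) TN : (0 < r.+1 <= N)%N) iS.
have hm : gap_eps hn p eps i < 2 * eps_ r.+1 by rewrite /gap_eps gt_max hg; lra.
have e2 : 0 < 2 ^+ r.+1 :> R by rewrite exprn_gt0.
have : 2 ^+ r.+1 * gap_eps hn p eps i <= 2.
  by move: hm; rewrite /eps_ ltr_pdivlMr// mulrC => /ltW.
rewrite [in X in _ -> X]exprS -mulrA; move: (_ * _) => y; lra.
Qed.

Definition arm_bound i : R :=
  k%:R^-1 * (1 / gap_eps hn p eps i ^+ 2 *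
     ln (n%:R / delta * Num.max 1 (ln (1 / gap_eps hn p eps i)))).

Lemma pull_bound_sum :
  pull_bound k hn p eps delta = \sum_(i < n | i != a1) arm_bound i.
Proof. by rewrite /pull_bound mulr_sumr. Qed.

Lemma arm_bound_ge0 i : 0 <= arm_bound i.
Proof.
have /andP[d0 d1] := d01.
rewrite mulr_ge0 ?invr_ge0// mulr_ge0 ?divr_ge0 ?sqr_ge0// ln_ge0//.
have q1 : 1 <= n%:R / delta :> R.
  rewrite ler_pdivlMr// mul1r.
  by apply: le_trans (ltW d1) _; rewrite ler1n ltnW.
by apply: mulr_ege1 => //; rewrite le_max lexx.
Qed.

(* 224 = 2 * 4 ^ 2 * 7. *)
Lemma t_le_arm_bound i r : i != a1 -> (0 < r <= T)%N -> i \in S r.-1 ->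
  t_ k n delta r <= 224 * arm_bound i.
Proof.
move=> ia rT iS; have h2 := survivor_round ia rT iS.
have D01 := gap_eps01 ia.
move/andP: rT => [r0 rT].
have hl := ln_round_le hn r0 d01 D01 h2.
have l0 : 0 <= ln (4 * n%:R * r%:R ^+ 2 / delta).
  by rewrite ln_ge0// ltW// ln_arg_gt1.
move: h2 hl l0; rewrite /arm_bound.
set D := gap_eps _ _ _ _ in D01 *; set l := ln _; set l' := ln _ => h2 hl l0.
case/andP: D01 => D0 _.
have -> : t_ k n delta r = k%:R^-1 * (2 * (2 ^+ r) ^+ 2 * l).
  case: r r0 {rT iS h2 hl l0} @l => // r _ l.
  by rewrite /t_ /eps_ -/l exprVn invfM invrK; ring.
have -> : 224 * (k%:R^-1 * (1 / D ^+ 2 * l')) =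
    k%:R^-1 * (2 * (4 / D) ^+ 2 * (7 * l')).
  by field; rewrite !gt_eqF// ltr0n.
apply: ler_wpM2l; first by rewrite invr_ge0.
apply: ler_pM => //.
apply: ler_wpM2l => //; rewrite ler_sqr ?nnegrE ?exprn_ge0//.
by rewrite divr_ge0// ltW.
Qed.

(** Some suboptimal arm is sampled in round [r]: [arm2] in round 1, and later one that exists
    because the previous round did not stop with a single arm. Its bound is one summand of
    [pull_bound]. *)
Lemma t_le_pull_bound r : (0 < r <= T)%N ->
  t_ k n delta r <= 224 * pull_bound k hn p eps delta.
Proof.
move=> rT.
have [i ia iS] : exists2 i, i != a1 & i \in S r.-1.
  case: r rT => // -[_|r rT]; first by exists (arm2 hn); rewrite ?inE.
  have [_ _ /(_ r.+1 rT)] := stopT; rewrite negb_or => /andP[_ c1].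
  have a1S : a1 \in S r.+1.
    by apply: best_arm_survives; apply: leq_trans TN; exact: ltnW.
  have : S r.+1 :\ a1 != finset.set0.
    apply: contraNneq c1 => h; apply/cards1P; exists a1.
    by rewrite -(finset.setD1K a1S) h finset.setU0.
  case/finset.set0Pn => i; rewrite finset.in_setD1 => /andP[ia iS].
  by exists i.
apply: (le_trans (t_le_arm_bound ia rT iS)).
rewrite ler_pM2l// pull_bound_sum (bigD1 i)//= lerDl sumr_ge0// => j _.
exact: arm_bound_ge0.
Qed.

(** The increments telescope to at most [pulls_upto] at the last round in which [i] is sampled; the
    induction on [T] drops the rounds after it. *)
Lemma arm_pulls_le i (B : R) : 0 <= B ->
  (forall r, (0 < r <= T)%N -> i \in S r.-1 ->
    (@pulls_upto R k n delta r)%:R <= B) ->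
  (\sum_(1 <= r < T.+1 | i \in S r.-1)
     (@pulls_upto R k n delta r - @pulls_upto R k n delta r.-1))%:R <= B.
Proof.
move=> B0; set m := @pulls_upto R k n delta.
have tel t : (\sum_(1 <= r < t.+1 | i \in S r.-1) (m r - m r.-1) <= m t)%N.
  elim: t => [|t IH]; first by rewrite big_geq.
  rewrite big_mkcond big_nat_recr//= -big_mkcond.
  (* Monotonicity makes the truncated difference a true one. *)
  have mm : (m t <= m t.+1)%N by exact: pulls_homo.
  case: ifP => _; first by rewrite -[leqRHS](subnKC mm) leq_add2r.
  by rewrite addn0; exact: leq_trans mm.
elim: T => [|t IH] H; first by rewrite big_geq.
have [iS|iS] := boolP (i \in S t).
  have := H t.+1; rewrite leqnn => /(_ isT iS).
  by apply: le_trans; rewrite ler_nat tel.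
rewrite big_mkcond big_nat_recr//= -big_mkcond (negbTE iS) addn0.
by apply: IH => r /andP[r0 rt]; apply: H; rewrite r0 ltnW.
Qed.

(** The parameters [c] and [e] describe the cost of rounding. The constant is 448 = 2 * 224: the
    suboptimal arms together cost 224 times [pull_bound], and the optimal arm at most as much
    again. *)
Lemma pulls_per_player_le (c e : R) : 0 <= c -> 0 <= e ->
  (forall r, (0 < r)%N ->
    (@pulls_upto R k n delta r)%:R <= c * t_ k n delta r + e) ->
  (pulls_per_player delta x T)%:R <=
    c * 448 * pull_bound k hn p eps delta + n%:R * e.
Proof.
move=> c0 e0 hm; set PB := pull_bound _ _ _ _ _.
have PB0 : 0 <= PB.
  by rewrite /PB pull_bound_sum sumr_ge0// => i _; exact: arm_bound_ge0.
pose B i := (if i == a1 then c * (224 * PB) else c * (224 * arm_bound i)).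
have B0 i : 0 <= B i.
  by rewrite /B; case: ifP => _; rewrite mulr_ge0// mulr_ge0// arm_bound_ge0.
have -> : pulls_per_player delta x T = (\sum_(i < n)
    \sum_(1 <= r < T.+1 | i \in S r.-1)
     (@pulls_upto R k n delta r - @pulls_upto R k n delta r.-1))%N.
  rewrite /pulls_per_player; under eq_bigr do rewrite big_mkcond.
  by rewrite exchange_big /=; apply: eq_bigr => i _; rewrite -big_mkcond.
rewrite natr_sum; apply: (@le_trans _ _ (\sum_(i < n) (B i + e))).
  apply: ler_sum => i _; apply: arm_pulls_le; first by rewrite addr_ge0.
  move=> r rT iS; apply: (le_trans (hm r _)); first by case/andP: rT.
  rewrite lerD2r /B; case: eqVneq => [_|ia]; apply: ler_wpM2l => //.
    exact: t_le_pull_bound.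
  exact: t_le_arm_bound.
rewrite big_split /= sumr_const card_ord mulr_natl lerD2r (bigD1 a1)//= {1}/B eqxx.
under eq_bigr => i ia do rewrite /B (negbTE ia).
rewrite -mulr_sumr -mulr_sumr -pull_bound_sum -/PB; lra.
Qed.

End Stopped.
End Run.

(** * Measurability *)

Section DiscreteMeasurability.
Local Open Scope classical_set_scope.
Context d (T : measurableType d).

Lemma measurable_const (Q : Prop) : measurable [set _ : T | Q].
Proof.
have [q|q] := pselect Q.
  by rewrite (_ : [set _ | _] = setT)//; apply/seteqP; split.
by rewrite (_ : [set _ | _] = set0)//; apply/seteqP; split.
Qed.

Lemma measurable_and (A B : T -> Prop) : measurable [set w | A w] ->
  measurable [set w | B w] -> measurable [set w | A w /\ B w].
Proof. exact: measurableI. Qed.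

Lemma measurable_imply (Q : Prop) (A : T -> Prop) :
  measurable [set w | A w] -> measurable [set w | Q -> A w].
Proof.
move=> mA; have [q|q] := pselect Q.
  by rewrite (_ : [set w | _] = [set w | A w])//; apply/seteqP; split=> w //=; apply.
by rewrite (_ : [set w | _] = setT)//; apply/seteqP; split=> w //= _ /q.
Qed.

Lemma measurable_forall_nat (A : nat -> T -> Prop) :
  (forall r, measurable [set w | A r w]) -> measurable [set w | forall r, A r w].
Proof.
move=> mA; rewrite (_ : [set w | _] = \bigcap_r [set w | A r w]).
  exact: bigcapT_measurable.
by apply/seteqP; split=> w /= H r; [move=> _; exact: H|exact: (H r)].
Qed.

Lemma measurable_exists_count (U : countType) (A : U -> T -> Prop) :
  (forall r, measurable [set w | A r w]) -> measurable [set w | exists r, A r w].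
Proof.
move=> mA; rewrite (_ : [set w | _] = \bigcup_r [set w | A r w]).
  by apply: countable_bigcupT_measurable.
by apply/seteqP; split=> w /= => [[r Ar]|[r _ Ar]]; exists r.
Qed.

(** The event splits over the countably many values of [f], so [f w] can be treated as a
    constant. *)
Lemma measurable_subst (U : countType) (f : T -> U) (A : U -> T -> Prop) :
  (forall u, measurable [set w | f w = u]) ->
  (forall u, measurable [set w | A u w]) -> measurable [set w | A (f w) w].
Proof.
move=> mf mA.
rewrite (_ : [set w | _] = [set w | exists u, f w = u /\ A u w]).
  by apply: measurable_exists_count => u; exact: measurable_and.
by apply/seteqP; split=> w /= => [|[u [<-]]]//; exists (f w).
Qed.

Lemma measurable_finset_valued (I : finType) (f : T -> {set I}) :
  (forall i, measurable [set w | i \in f w]) ->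
  forall A, measurable [set w | f w = A].
Proof.
move=> mf A.
rewrite (_ : [set w | _] =
    \bigcap_(i in [set: I]) [set w | (i \in f w) = (i \in A)]).
  apply: fin_bigcap_measurable => // i _; case: (i \in A); first exact: mf.
  rewrite (_ : [set w | _] = ~` [set w | i \in f w]); first exact: measurableC.
  by apply/seteqP; split=> w /= => [->//|/negP/negbTE].
apply/seteqP; split=> w /= => [fA i _ /=|H]; first by rewrite fA.
by apply/setP => i; exact: H.
Qed.

Lemma measure_bigsetU_le (R : realType) (mu : {measure set T -> \bar R})
    (I : Type) (s : seq I) (F : I -> set T) : (forall i, measurable (F i)) ->
  (mu (\big[setU/set0]_(i <- s) F i) <= \sum_(i <- s) mu (F i))%E.
Proof.
move=> mF; elim: s => [|i s IH]; first by rewrite !big_nil measure0.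
rewrite !big_cons; apply: (@le_trans _ _
    (mu (F i) + mu (\big[setU/set0]_(j <- s) F j))%E).
  by apply: measureU2 => //; exact: bigsetU_measurable.
by rewrite leeD2l.
Qed.

End DiscreteMeasurability.

(** * Measurability of the events of a run *)

Section SurvivorsMeasurability.
Local Open Scope classical_set_scope.
Context (R : realType) (k n : nat) d (T : measurableType d) (P : probability T R).
Context (X : 'I_k -> 'I_n -> nat -> {RV P >-> R}) (delta : R).
Let x w : 'I_k -> 'I_n -> nat -> R := fun j i s => X j i s w.

Lemma measurable_joint_mean r i :
  measurable_fun [set: T] (fun w => joint_mean delta (x w) r i).
Proof.
apply: measurable_funM => //; apply: measurable_sum => j.
by apply: measurable_funM => //; apply: measurable_sum => s.
Qed.

Lemma measurable_survivors r A :
  measurable [set w | survivors delta (x w) r = A].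
Proof.
elim: r A => [|r IH] A /=; first exact: measurable_const.
(* Once the previous set is frozen to [B], membership in the next one compares two measurable
   functions. *)
pose step (B : {set 'I_n}) w := (B :\: finset (fun i => (i \in B) &&
  (joint_mean delta (x w) r.+1 i <
   \big[Num.max/0]_(i in B) joint_mean delta (x w) r.+1 i - eps_ r.+1)))%SET.
apply: (@measurable_subst _ _ _ (fun w => survivors delta (x w) r)
  (fun B w => step B w = A)) => // B; apply: measurable_finset_valued => i.
under eq_set do rewrite /step !inE.
case: (i \in B) => /=; last exact: measurable_const.
under eq_set do rewrite andbT -leNgt.
rewrite -[X in measurable X]setTI; apply: measurable_fun_le => //.
  apply: measurable_funB => //.
  elim: (index_enum _) => [|j s IHs].
    under eq_fun do rewrite big_nil.
    exact: measurable_cst.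
  under eq_fun do rewrite big_cons.
  case: (j \in B) => //.
  by apply: measurable_maxr => //; exact: measurable_joint_mean.
exact: measurable_joint_mean.
Qed.

Lemma measurable_survivorsP r (A : {set 'I_n} -> Prop) :
  measurable [set w | A (survivors delta (x w) r)].
Proof.
apply: (@measurable_subst _ _ _ (fun w => survivors delta (x w) r)
  (fun B w => A B)); [exact: measurable_survivors|].
by move=> u; exact: measurable_const.
Qed.

Lemma measurable_stops_at eps t :
  measurable [set w | stops_at eps delta (x w) t].
Proof.
rewrite (_ : [set w | _] = [set w | (0 < t)%N /\ (stop_test eps delta (x w) t /\
  forall r, (0 < r < t)%N -> ~~ stop_test eps delta (x w) r)]); last first.
  by apply/seteqP; split=> w /= [] => [h1 h2 h3|h1 [h2 h3]].
apply: measurable_and; first exact: measurable_const.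
apply: measurable_and.
  exact: (measurable_survivorsP t (fun A => (eps_ t <= eps / 2) || (#|A| == 1%N))).
apply: measurable_forall_nat => r; apply: measurable_imply.
exact: (measurable_survivorsP r
  (fun A => ~~ ((eps_ r <= eps / 2) || (#|A| == 1%N)))).
Qed.

Lemma measurable_pulls_le t (b : R) :
  measurable [set w | (pulls_per_player delta (x w) t)%:R <= b].
Proof.
rewrite -[X in measurable X]setTI.
apply: (@measurable_fun_le _ _ _ _ _ (cst b)) => //.
rewrite /pulls_per_player.
(* Indicators turn the sum over a random set into a sum over a fixed one. *)
have -> : (fun w => (\sum_(1 <= r < t.+1) \sum_(i in survivors delta (x w) r.-1)
     (@pulls_upto R k n delta r - @pulls_upto R k n delta r.-1))%:R : R) =
  (fun w => \sum_(1 <= r < t.+1) \sum_(i < n)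
    \1_[set w | i \in survivors delta (x w) r.-1] w *
     (@pulls_upto R k n delta r - @pulls_upto R k n delta r.-1)%:R).
  apply/funext => w; rewrite natr_sum; apply: eq_bigr => r _.
  rewrite natr_sum big_mkcond; apply: eq_bigr => i _.
  rewrite indicE.
  have -> : (w \in [set w | i \in survivors delta (x w) r.-1]) =
     (i \in survivors delta (x w) r.-1) by apply/idP/idP; rewrite inE.
  by case: ifP => _; rewrite ?mul1r ?mul0r.
apply: measurable_sum => r; apply: measurable_sum => i.
apply: measurable_funM => //; apply: measurable_indic.
exact: (measurable_survivorsP r.-1 (fun A => i \in A)).
Qed.

End SurvivorsMeasurability.

(** * The union bound *)

Lemma sum_inv_sqr_le2 (R : realType) (N : nat) :
  \sum_(1 <= r < N.+1) (r%:R ^+ 2)^-1 <= 2 :> R.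
Proof.
(* The sharper bound telescopes, since the new term is at most the difference of consecutive
   inverses. The induction step starts from 1 because of the convention that 0 has inverse 0. *)
suff : \sum_(1 <= r < N.+1) (r%:R ^+ 2)^-1 <= 2 - N%:R^-1 :> R.
  by move=> /le_trans; apply; rewrite gerBl invr_ge0.
elim: N => [|[|N] IH]; first by rewrite big_geq// invr0 subr0.
  by rewrite big_nat1 expr1n invr1; lra.
rewrite big_nat_recr//=; apply: (le_trans (lerD IH (lexx _))).
have N0 : 0 < N.+1%:R :> R by [].
rewrite -[N.+2]addn1 natrD; move: N0; set y := N.+1%:R => y0.
have z0 : 0 < y + 1 by lra.
have -> : 2 - (y + 1)^-1 = 2 - y^-1 + (y * (y + 1))^-1 by field; lra.
rewrite lerD2l lef_pV2 ?posrE ?exprn_gt0 ?mulr_gt0//; nra.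
Qed.

Section GoodEvent.
Local Open Scope classical_set_scope.
Context (R : realType) (k n : nat) (delta : R).
Hypotheses (k0 : (0 < k)%N) (n1 : (1 < n)%N) (d01 : 0 < delta < 1).
Context d (T : measurableType d) (P : probability T R).
Context (p : 'I_n -> R) (X : 'I_k -> 'I_n -> nat -> {RV P >-> R}).
Hypothesis BX : bandit_rewards p X.
Variable N : nat.
Let jmean w := joint_mean delta (fun j i s => X j i s w).

Let bad r i := [set w | eps_ r / 2 <= `|jmean w r i - p i|].

Let mbad r i : measurable (bad r i).
Proof.
rewrite -[X in measurable X]setTI; apply: measurable_fun_le => //.
apply: measurableT_comp => //; apply: measurable_funB => //.
exact: measurable_joint_mean.
Qed.

Definition all_means_close : set T := [set w | forall r i,
  (0 < r <= N)%N -> `|jmean w r i - p i| < eps_ r / 2].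

Let all_means_closeE : all_means_close =
  ~` (\big[setU/set0]_(r <- index_iota 1 N.+1)
        \big[setU/set0]_(i <- enum 'I_n) bad r i).
Proof.
apply/seteqP; split=> w /=.
  move=> H; rewrite -bigcup_seq => -[r /=]; rewrite mem_index_iota ltnS => rN.
  by rewrite -bigcup_seq => -[i _]; rewrite /bad /= leNgt H.
move=> H r i rN; rewrite ltNge; apply/negP => Hb; apply: H.
rewrite -bigcup_seq; exists r; first by rewrite /= mem_index_iota ltnS.
by rewrite -bigcup_seq; exists i => //=; rewrite mem_enum.
Qed.

Let mU (r : nat) : measurable (\big[setU/set0]_(i <- enum 'I_n) bad r i).
Proof. exact: bigsetU_measurable. Qed.

Lemma measurable_all_means_close : measurable all_means_close.
Proof.
by rewrite all_means_closeE; apply: measurableC; exact: bigsetU_measurable.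
Qed.

(** In round [r] the [n] arms fail with total probability at most [delta / (2 * r ^ 2)], and the
    inverse squares sum to at most 2. *)
Lemma all_means_close_prob : ((1 - delta)%:E <= P all_means_close)%E.
Proof.
have /andP[d0 d1] := d01.
rewrite all_means_closeE probability_setC; last exact: bigsetU_measurable.
rewrite EFinB; apply: leeB => //.
apply: (le_trans (measure_bigsetU_le P _ mU)).
apply: (@le_trans _ _ (\sum_(1 <= r < N.+1) (delta / 2 * (r%:R ^+ 2)^-1)%:E)%E).
  rewrite big_seq [leRHS]big_seq; apply: lee_sum => r.
  rewrite mem_index_iota => /andP[r0 _].
  apply: (le_trans (measure_bigsetU_le P _ (mbad r))).
  apply: (@le_trans _ _
    (\sum_(i <- enum 'I_n) (delta / (2 * n%:R * r%:R ^+ 2))%:E)%E).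
    by apply: lee_sum => i _; exact: joint_mean_concentration.
  rewrite sumEFin big_enum /= sumr_const card_ord lee_fin -mulr_natl.
  rewrite le_eqVlt; apply/orP; left; apply/eqP.
  by field; rewrite !pnatr_eq0 -!lt0n r0 ltnW.
rewrite sumEFin lee_fin -mulr_sumr.
have := sum_inv_sqr_le2 R N; nra.
Qed.

End GoodEvent.

(** * Inclusion of the good event in the event of success *)

Theorem theorem4p1 (R : realType) :
  exists C : R, 0 < C /\
  forall (k n : nat) (hk : (1 <= k)%N) (hn : (2 <= n)%N)
    (d : measure_display) (Omega : measurableType d) (P : probability Omega R)
    (p : 'I_n -> R) (X : 'I_k -> 'I_n -> nat -> {RV P >-> R})
    (eps delta : R),
  bandit_rewards p X ->
  (forall i j : 'I_n, (i <= j)%N -> p j <= p i) ->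
  0 <= eps <= 1 ->
  (eps = 0 -> 0 < min_gap hn p) ->
  0 < delta < 1 ->
  ((1 - delta)%:E <=
   P [set w | (let x := fun j i s => X j i s w in
        exists T : nat,
        [/\ stops_at eps delta x T,
            (0 < #|survivors delta x T|)%N /\
            (forall i, i \in survivors delta x T ->
               eps_optimal hn p eps i /\ (eps = 0 -> i = arm1 hn)),
            (pulls_per_player delta x T)%:R
              <= C * pull_bound k hn p eps delta + n%:R,
            1 <= t_ k n delta 1 ->
            (pulls_per_player delta x T)%:R
              <= C * pull_bound k hn p eps delta
          & T%:Z <= round_bound hn p eps])%R]%classic)%E.
Proof.
(* The constant is kept abstract: [//] would unfold it to unary form. *)
have [c c0 cE] : exists2 c : R, 0 < c & c = 448.
  exists 448; last exact: erefl.
  by rewrite ltr0n.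
(* The factor 2 absorbs the rounding in the bound without [n%:R]. *)
exists (2 * c); split=> [|k n hk]; first by rewrite mulr_gt0.
move=> hn d Omega P p X eps delta BX ps eps01 mg d01.
have p01 i : 0 <= p i <= 1.
  exact: (mean_in01 (reward_in01 BX (Ordinal hk) i 0) (reward_mean BX _ i 0)).
pose N := last_round hn p eps.
apply: (le_trans (all_means_close_prob hk hn d01 BX N)).
apply: le_measure; rewrite ?inE.
- exact: measurable_all_means_close.
- apply: measurable_exists_count => T.
  set A := (X in measurable X).
  have -> : A = [set w | stops_at eps delta (fun j i s => X j i s w) T /\
    (((0 < #|survivors delta (fun j i s => X j i s w) T|)%N /\
       (forall i, i \in survivors delta (fun j i s => X j i s w) T ->
         eps_optimal hn p eps i /\ (eps = 0 -> i = arm1 hn))) /\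
    ((pulls_per_player delta (fun j i s => X j i s w) T)%:R
              <= 2 * c * pull_bound k hn p eps delta + n%:R /\
    ((1 <= t_ k n delta 1 ->
      (pulls_per_player delta (fun j i s => X j i s w) T)%:R
              <= 2 * c * pull_bound k hn p eps delta) /\
     T%:Z <= round_bound hn p eps)))]%classic.
    by apply/seteqP; split=> w /= [] => [? ? ? ? ?|? [? [? [? ?]]]].
  apply: measurable_and; first exact: measurable_stops_at.
  apply: measurable_and.
    exact: (measurable_survivorsP X delta T (fun S => (0 < #|S|)%N /\
       (forall i, i \in S ->
         eps_optimal hn p eps i /\ (eps = 0 -> i = arm1 hn)))).
  apply: measurable_and; first exact: measurable_pulls_le.
  apply: measurable_and; last exact: measurable_const.
  by apply: measurable_imply; exact: measurable_pulls_le.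
move=> w /= good; pose x j i s := X j i s w.
have x0 j i s : 0 <= x j i s by case/andP: (reward_in01 BX j i s w).
have [T stopT TN] := stops_by_last_round ps p01 x0 eps01 mg good.
have pl := pulls_per_player_le hk d01 ps p01 x0 eps01 mg good stopT TN.
rewrite -cE in pl.
have PB0 : 0 <= pull_bound k hn p eps delta.
  rewrite pull_bound_sum sumr_ge0// => i _.
  exact: arm_bound_ge0.
exists T; split=> //.
- split; first by apply/card_gt0P; exists (arm1 hn); exact: best_arm_survives TN.
  by move=> i; apply: survivors_optimal.
(* Rounding is charged additively, one pull for each arm. *)
- apply: (@le_trans _ _ (1 * c * pull_bound k hn p eps delta + n%:R * 1)).
    by apply: pl => // r _; rewrite mul1r; exact: pulls_le.
  by rewrite mul1r mulr1 lerD2r -mulrA ler_peMl ?ler1n// mulr_ge0// ltW.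
(* Here [1 <= t_ 1 <= t_ r], so rounding up at most doubles [t_ r]. *)
- move=> t1; rewrite -[leRHS]addr0 -[X in _ + X](mulr0 n%:R).
  apply: pl => // r r0; rewrite addr0.
  apply: (le_trans (pulls_le hk hn d01 r)).
  have : 1 <= t_ k n delta r by apply: le_trans t1 (t_homo hk hn d01 r0).
  lra.
- by rewrite -(round_boundE p01 eps01 mg) lez_nat.
Qed.
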